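(* Let $M=\langle S,A,P,r,\mu,\gamma\rangle$ be a finite Markov decision process, $\phi$ a propositional logic formula over atomic propositions labelling the states, $p\in[0,1]$, and $\bowtie\,\in\{\le,\ge,>,<\}$. Given the formula $P_{\bowtie p}(\mathsf{X}\,\phi)$, define the cost function $d:S\times A\to\mathbb{R}$ by $d(s,a)=\mathbf{E}_{s'\sim P(\cdot\mid s,a)}\mathbf{1}(s'\models\phi)$. Given a Markov randomized policy $\pi$, the $\pi$-induced Markov chain satisfies the formula, denoted $M^\pi\models P_{\bowtie p}(\mathsf{X}\,\phi)$, if and only if $D(X_0,T;\pi)\bowtie p$ and the stopping time is $T=2$.
   Context: $S,A$ are finite, $P(\cdot\mid s,a)$ is the next-state distribution, $r$ is a reward function (not used here), $\mu$ is the initial state distribution, and the discount factor is taken to be $\gamma=1$. A Markov randomized policy $\pi$ assigns to each state $s$ a distribution $\pi(\cdot\mid s)$ over the set $A(s)$ of admissible actions; $M^\pi=\{X_n,n\ge0\}$ with actions $A_n$ is the induced Markov chain, with $X_0\sim\mu$, $A_t\sim\pi(\cdot\mid X_t)$, $X_{t+1}\sim P(\cdot\mid X_t,A_t)$. $s\models\phi$ means that the state $s$ satisfies $\phi$, and $\mathbf{1}$ is the indicator function. A path $s_0s_1s_2\ldots$ satisfies $\mathsf{X}\,\phi$ (''next $\phi$'') iff $s_1\models\phi$. A state $s$ satisfies $P_{\bowtie p}(\psi)$ under $\pi$ iff the probability of the set of paths starting from $s$ and following $\pi$ that satisfy $\psi$ is $\bowtie p$; $M^\pi\models P_{\bowtie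 p}(\psi)$ means that this holds for the chain started at $X_0$. For a stopping time $T$, the total cost when starting at state $s$ with action $a$ and then following $\pi$ is $D(s,a,T;\pi)=\sum_{t=0}^{T-1}\gamma^t d(X_t,A_t)$ given $X_0=s$, $A_0=a$ (understood in expectation over the chain), and $D(s,T;\pi)=\sum_{a\in A(s)}D(s,a,T;\pi)\,\pi(a\mid s)$, with $\gamma=1$.
   Formalization: The stopping time is T=1 instead of T=2: since D sums over t=0,...,T-1, T=2 would also count d(X_1,A_1), and the claim fails for φ true, ≤ and p=1 (probability 1, but D=2). *)

(* Defs.v *)
(* MathComp with MathComp-Analysis. *)
From HB Require Import structures.
From mathcomp Require Import all_boot all_order all_algebra.
From mathcomp Require Import all_classical all_reals all_analysis.

Set Implicit Arguments.
Unset Strict Implicit.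
Unset Printing Implicit Defensive.

Import Order.TTheory GRing.Theory Num.Theory.
Import numFieldNormedType.Exports.

Local Open Scope classical_set_scope.
Local Open Scope ring_scope.

(* Transition probabilities are constrained at admissible pairs only: what
   [trans s a] is for [a \notin adm s] never matters. *)
Record mdp (R : realType) (S A : finType) := MDP {
  adm : S -> {set A};
  trans : S -> A -> S -> R;
  reward : S -> A -> R;
  init : S -> R;
  discount : R;
  trans_ge0 : forall s a s', a \in adm s -> 0 <= trans s a s';
  trans_sum1 : forall s a, a \in adm s -> \sum_s' trans s a s' = 1;
  init_ge0 : forall s, 0 <= init s;
  init_sum1 : \sum_s init s = 1 }.

(* Markov randomized policy; [policy_supp] makes each [policy_prob s] a
   distribution over [adm M s], so that in particular [adm M s] is nonempty. *)
Record policy (R : realType) (S A : finType) (M : mdp R S A) := Policy {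
  policy_prob :> S -> A -> R;
  policy_ge0 : forall s a, 0 <= policy_prob s a;
  policy_supp : forall s a, a \notin adm M s -> policy_prob s a = 0;
  policy_sum1 : forall s, \sum_a policy_prob s a = 1 }.

Inductive prop_formula (AP : Type) :=
| FTrue
| FAtom of AP
| FNot of prop_formula AP
| FAnd of prop_formula AP & prop_formula AP
| FOr of prop_formula AP & prop_formula AP
| FImp of prop_formula AP & prop_formula AP.
Arguments FTrue {AP}.

Fixpoint sat (S AP : Type) (L : S -> pred AP) (s : S)
    (phi : prop_formula AP) : bool :=
  match phi with
  | FTrue => true
  | FAtom q => L s q
  | FNot f => ~~ sat L s f
  | FAnd f g => sat L s f && sat L s g
  | FOr f g => sat L s f || sat L s g
  | FImp f g => sat L s f ==> sat L s g
  end.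

Inductive path_formula (AP : Type) := Next of prop_formula AP.

Definition path_sat (S AP : Type) (L : S -> pred AP) (w : nat -> S)
    (psi : path_formula AP) : bool :=
  match psi with Next phi => sat L (w 1%N) phi end.

Inductive comparison_op := CmpLe | CmpGe | CmpGt | CmpLt.

Definition compare (R : realType) (c : comparison_op) (x y : \bar R) : bool :=
  match c with
  | CmpLe => (x <= y)%E
  | CmpGe => (y <= x)%E
  | CmpGt => (y < x)%E
  | CmpLt => (x < y)%E
  end.

(* The formula P_{c p}(psi). *)
Inductive prob_formula (R : realType) (AP : Type) :=
  Prob of comparison_op & R & path_formula AP.

Section Chain.
Context (R : realType) (S A : finType) (M : mdp R S A) (pi : policy M).

Definition history_event (Omega : Type) (X : nat -> Omega -> S)
    (Act : nat -> Omega -> A) (n : nat) (x : nat -> S) (a : nat -> A) :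
    set Omega :=
  [set w | forall t, (t <= n)%N -> X t w = x t /\ Act t w = a t].

(* Under [Pr], the pair (X_0, A_0) has mass function [nu] and, given the
   history up to time n, X_{n+1} ~ trans(. | X_n, A_n) and then
   A_{n+1} ~ pi(. | X_{n+1}). *)
Definition chain_law d (Omega : measurableType d) (X : nat -> Omega -> S)
    (Act : nat -> Omega -> A) (Pr : probability Omega R)
    (nu : S -> A -> R) : Prop :=
  (forall x a, Pr (history_event X Act 0 x a) = (nu (x 0%N) (a 0%N))%:E) /\
  (forall n x a,
     Pr (history_event X Act n.+1 x a) =
     (Pr (history_event X Act n x a) *
      (trans M (x n) (a n) (x n.+1) * pi (x n.+1) (a n.+1))%:E)%E).

(* The chain M^pi: one sample space with state and action processes, carrying
   the law of the chain with X_0 ~ init and, for each admissible (s, a), the law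
   of the chain with X_0 = s, A_0 = a that follows [pi] afterwards.  For a
   finite MDP the space of paths with the Ionescu-Tulcea measures is such a
   chain; results are stated for an arbitrary one. *)
Record induced_chain := InducedChain {
  chain_disp : measure_display;
  sample : measurableType chain_disp;
  state : nat -> sample -> S;
  act : nat -> sample -> A;
  prob_init : probability sample R;
  prob_from : S -> A -> probability sample R;
  state_meas : forall n s, measurable (state n @^-1` [set s]);
  act_meas : forall n a, measurable (act n @^-1` [set a]);
  prob_initP : chain_law state act prob_init (fun s a => init M s * pi s a);
  prob_fromP : forall s a, a \in adm M s ->
    chain_law state act (prob_from s a)
      (fun s' a' => ((s' == s) && (a' == a))%:R) }.

Arguments state C n w : rename, clear implicits.
Arguments act C n w : rename, clear implicits.

Definition chain_sat (AP : Type) (L : S -> pred AP) (C : induced_chain)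
    (f : prob_formula R AP) : bool :=
  match f with
  | Prob c p psi =>
      compare c (prob_init C [set w | path_sat L (fun n => state C n w) psi]) p%:E
  end.

Local Open Scope ereal_scope.

(* D(s, a, T; pi) *)
Definition cost_sa (C : induced_chain) (d : S -> A -> R)
    (T : sample C -> nat) (s : S) (a : A) : \bar R :=
  'E_(prob_from C s a)
    [fun w => (\sum_(0 <= t < T w)
                 discount M ^+ t * d (state C t w) (act C t w))%R].

(* D(s, T; pi) *)
Definition cost_s (C : induced_chain) (d : S -> A -> R)
    (T : sample C -> nat) (s : S) : \bar R :=
  \sum_(a in adm M s) cost_sa d T s a * (pi s a)%:E.

(* D(X_0, T; pi), in expectation over X_0 *)
Definition cost_init (C : induced_chain) (d : S -> A -> R)
    (T : sample C -> nat) : \bar R :=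
  \int[prob_init C]_w cost_s d T (state C 0 w).

End Chain.

Arguments state {R S A M pi} C n w : rename.
Arguments act {R S A M pi} C n w : rename.

(* d(s, a) = E_{s' ~ trans(. | s, a)} 1(s' |= phi) *)
Definition next_cost (R : realType) (S A : finType) (M : mdp R S A)
    (AP : Type) (L : S -> pred AP) (phi : prop_formula AP) (s : S) (a : A) : R :=
  \sum_s' trans M s a s' * (sat L s' phi)%:R.

(* Main.v *)
Require Import Defs.
From mathcomp Require Import all_boot all_order all_algebra.
From mathcomp Require Import all_classical all_reals all_analysis.

(** Both sides compare with [p] one and the same number, the sum over [s] and
    [a] of [init s * pi s a * next_cost s a].  The probability of [X_1 |= phi]
    has this value: the pair [(X_0, A_0)] has mass function [init s * pi s a],
    and given it, [X_1] satisfies [phi] with probability [next_cost s a].  The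
    cost stopped at time 1 is the single term [d(X_0, A_0)], so its expectation
    is the same sum.

    Every random quantity involved is a function of [(X_0, A_0)] or of
    [(X_0, A_0, X_1, A_1)], which take finitely many values, so all integrals
    are finite sums over the mass functions prescribed by [chain_law]
    ([integral_init_pair], [integral_two_pairs]).  The two sums are computed in
    [chain_sat_value] and [cost_init_value]. *)

Import GRing.Theory.
Local Open Scope classical_set_scope.
Local Open Scope ring_scope.

(** * Integrals of functions of a finitely valued random variable *)

Section FiniteValued.
Context {R : realType} {d : measure_display} {Omega : measurableType d}.
Variable Pr : probability Omega R.

Lemma integral_finite_valued (F : finType) (Y : Omega -> F) (f : F -> R) :
  (forall y, measurable (Y @^-1` [set y])) ->
  (\int[Pr]_w (f (Y w))%:E = \sum_y (f y)%:E * Pr (Y @^-1` [set y]))%E.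
Proof.
move=> mY.
have intY y : Pr.-integrable setT (fun w => (\1_(Y @^-1` [set y]) w)%:E).
  exact: integrable_indic.
under eq_integral => w _.
  rewrite (_ : (f (Y w))%:E =
     \sum_y (f y)%:E * (\1_(Y @^-1` [set y]) w)%:E)%E; last first.
    rewrite (bigD1 (Y w)) //= indicE mem_set //= mule1 big1 ?adde0 // => y yY.
    by rewrite indicE memNset ?mule0 // => /= e; rewrite e eqxx in yY.
  over.
rewrite integral_sum //; last first.
  by move=> y; apply: (integrableZl measurableT (f y) (intY y)).
apply: eq_bigr => y _.
by rewrite (integralZl measurableT (intY y)) integral_indic // setIT.
Qed.

End FiniteValued.

(** * The law of the first two state-action pairs *)

Section FirstSteps.
Context {R : realType} {S A : finType} {M : mdp R S A} { pi : policy M}.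
Context {d : measure_display} {Omega : measurableType d}.
Variables (X : nat -> Omega -> S) (Act : nat -> Omega -> A).
Variables (Pr : probability Omega R) (nu : S -> A -> R).
Hypothesis mX : forall n s, measurable (X n @^-1` [set s]).
Hypothesis mAct : forall n a, measurable (Act n @^-1` [set a]).
Hypothesis lawP : chain_law pi X Act Pr nu.

Let pair_at n w := (X n w, Act n w).

Let measurable_pair_at n y : measurable (pair_at n @^-1` [set y]).
Proof.
rewrite (_ : _ @^-1` _ = X n @^-1` [set y.1] `&` Act n @^-1` [set y.2]).
  exact: measurableI.
case: y => s a; apply/seteqP; split=> w /=; first by case=> -> ->.
by rewrite /pair_at => -[-> ->].
Qed.

Lemma integral_init_pair (f : S -> A -> R) :
  (\int[Pr]_w (f (X 0%N w) (Act 0%N w))%:E =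
   (\sum_s \sum_a f s a * nu s a)%:E)%E.
Proof.
rewrite (integral_finite_valued Pr _ _ (fun y => f y.1 y.2)
  (measurable_pair_at 0)).
rewrite pair_bigA /= -sumEFin; apply: eq_bigr => -[s a] _ /=.
rewrite EFinM; congr (_ * _)%E.
rewrite -(lawP.1 (fun=> s) (fun=> a)); congr (Pr _).
apply/seteqP; split=> w /=; first by case=> Xs Aa [|t].
by move=> /(_ 0%N (leqnn _)) [Xs Aa]; rewrite /pair_at Xs Aa.
Qed.

Lemma integral_two_pairs (f : S * A -> S * A -> R) :
  (\int[Pr]_w (f (X 0%N w, Act 0%N w) (X 1%N w, Act 1%N w))%:E =
   (\sum_y \sum_z
      f y z * (nu y.1 y.2 * (trans M y.1 y.2 z.1 * pi z.1 z.2)))%:E)%E.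
Proof.
have m2 y : measurable ((fun w => (pair_at 0 w, pair_at 1 w)) @^-1` [set y]).
  rewrite (_ : _ @^-1` _ =
    pair_at 0 @^-1` [set y.1] `&` pair_at 1 @^-1` [set y.2]).
    exact: measurableI.
  case: y => u v; apply/seteqP; split=> w /=; first by case=> <- <-.
  by case=> -> ->.
rewrite (integral_finite_valued Pr _ _ (fun y => f y.1 y.2) m2).
rewrite pair_bigA /= -sumEFin; apply: eq_bigr => -[[s a] [s' a']] _ /=.
rewrite EFinM; congr (_ * _)%E.
(* Histories up to time 1 only look at the times 0 and 1, so the values of
   these paths at later times are arbitrary. *)
pose x t := if t is 0%N then s else s'.
pose b t := if t is 0%N then a else a'.
rewrite EFinM -(lawP.1 x b) -(lawP.2 0%N x b); congr (Pr _).
apply/seteqP; split=> w /=; first by case=> X0 A0 X1 A1 [|[|t]].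
move=> h; have [X0 A0] := h 0%N isT; have [X1 A1] := h 1%N isT.
by rewrite /pair_at X0 A0 X1 A1.
Qed.

End FirstSteps.

(** * The two sides of the equivalence *)

Section Values.
Context {R : realType} {S A : finType} {M : mdp R S A} { pi : policy M}.
Variable C : induced_chain pi.

(** Summing the mass function over the last action [A_1] leaves the factor
    [\sum_a pi s' a = 1], and the remaining sum over [X_1] is [next_cost]. *)
Lemma chain_sat_value (AP : Type) (L : S -> pred AP) (phi : prop_formula AP) :
  prob_init C [set w | path_sat L (fun n => state C n w) (Next phi)] =
  (\sum_s \sum_a next_cost M L phi s a * (init M s * pi s a))%:E.
Proof.
set E := [set w | _].
have mE : measurable E.
  rewrite (_ : E =
    \bigcup_(s in [set s | sat L s phi]) state C 1 @^-1` [set s]).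
    by apply: fin_bigcup_measurable => // s _; exact: state_meas.
  apply/seteqP; split=> w /=; first by exists (state C 1 w).
  by move=> [s sphi ws]; rewrite /E /= ws.
rewrite -[X in prob_init C X]setIT -integral_indic //.
rewrite (eq_integral (fun w => (sat L (state C 1 w) phi)%:R%:E)); last first.
  move=> w _; rewrite indicE; congr ((nat_of_bool _)%:R%:E); exact: asboolb.
rewrite (integral_two_pairs _ _ _ _ (state_meas C) (act_meas C)
  (prob_initP C) (fun _ z => (sat L z.1 phi)%:R)).
congr EFin; rewrite [RHS]pair_bigA /=; apply: eq_bigr => -[s a] _ /=.
rewrite /next_cost mulr_suml.
rewrite -(pair_bigA _ (fun s' a' => (sat L s' phi)%:R *
  (init M s * pi s a * (trans M s a s' * pi s' a')))) /=.
apply: eq_bigr => s' _.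
by rewrite -!mulr_sumr policy_sum1 mulr1 mulrCA mulrC (mulrC _%:R).
Qed.

(** The law of the chain from [(s, a)] is prescribed only for an admissible
    [a], where the expected cost is [d s a].  This suffices, as [cost_s] sums
    over admissible actions and [pi] gives the others mass zero. *)
Lemma cost_init_value (d : S -> A -> R) :
  cost_init (C := C) d (fun=> 1%N) =
  (\sum_s \sum_a d s a * (init M s * pi s a))%:E.
Proof.
have cost_saE s a : a \in adm M s ->
    cost_sa (C := C) d (fun=> 1%N) s a = (d s a)%:E.
  move=> adm_a; rewrite /cost_sa unlock.
  under eq_integral do rewrite /= big_nat1 expr0 mul1r.
  rewrite (integral_init_pair _ _ _ _ (state_meas C) (act_meas C)
    (prob_fromP C adm_a)).
  rewrite (bigD1 s) //= (bigD1 a) //= !eqxx mulr1 !big1 ?addr0 //.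
    by move=> s' /negPf ne; rewrite big1 // => a' _; rewrite ne mulr0.
  by move=> a' /negPf ne; rewrite ne andbF mulr0.
have cost_sE s :
    cost_s (C := C) d (fun=> 1%N) s = (\sum_a d s a * pi s a)%:E.
  rewrite [in RHS](bigID (mem (adm M s))) /= [X in _ + X]big1 ?addr0.
    rewrite /cost_s -sumEFin; apply: eq_bigr => a adm_a.
    by rewrite (cost_saE s a adm_a) EFinM.
  by move=> a /policy_supp ->; rewrite mulr0.
rewrite /cost_init.
under eq_integral do rewrite cost_sE.
rewrite (integral_init_pair _ _ _ _ (state_meas C) (act_meas C)
  (prob_initP C) (fun s _ => \sum_a d s a * pi s a)).
congr EFin; apply: eq_bigr => s _.
rewrite -mulr_sumr -mulr_sumr policy_sum1 mulr1 mulr_suml.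
by apply: eq_bigr => a _; rewrite mulrAC mulrA.
Qed.

End Values.

(* [cost_sa] sums the costs at the times t with 0 <= t < T, hence the stopping
   time is the constant 1: the chain is stopped at its second state X_1.  With
   the constant 2 the sum would also contain d(X_1, A_1), and the equivalence
   would fail, e.g. for phi true, the comparison <=, and p = 1. *)
Theorem mainTheorem2 (R : realType) (S A : finType) (M : mdp R S A)
    (discount1 : discount M = 1)
    (AP : Type) (L : S -> pred AP) (phi : prop_formula AP)
    (p : R) (p01 : 0 <= p <= 1) (c : comparison_op)
    (pi : policy M) (C : induced_chain pi) :
  chain_sat L C (Prob c p (Next phi)) <->
  compare c (cost_init (C := C) (next_cost M L phi) (fun=> 1%N)) (p%:E)%E.
Proof. by rewrite /chain_sat chain_sat_value cost_init_value. Qed.
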